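(* Let $N$ be a finite group satisfying $\mathrm{Z}(N) \cap N' = 1$, let $A = \mathrm{Aut}(N)$, and define $$U_N = \mathrm{Hol}(N)/D, \qquad T_N = A/\gamma(N'),$$ where $D = \{(d^{-1}, \gamma_d) : d \in N'\} \unlhd \mathrm{Hol}(N)$. The following hold: (i) $N$ embeds as a normal subgroup of $U_N$, via $n \mapsto (n,1)D$. (In the following, $N$ is identified with its image $(N \times 1)D/D$ in $U_N$.) (ii) There is an epimorphism $\pi \colon U_N \to T_N$ with kernel $N$, namely the natural one, $(n,\alpha)D \mapsto \alpha\gamma(N')$. (iii) $N/N'$ has a complement in $U_N/N'$. (iv) If $B$ is a finite group with $N \unlhd B$ and $N/N'$ has a complement in $B/N'$, then $B$ is a fiber product of $\pi$ and some homomorphism $B/N \to T_N$, with $N$ identified with $N \times 1$. That is, there exist a homomorphism $\overline{f} \colon B/N \to T_N$ and an isomorphism from $B$ onto $$U_N \times_{T_N} (B/N) = \{(u,x) \in U_N \times (B/N) : \pi(u) = \overline{f}(x)\}$$ which carries $N$ onto $N \times 1$.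
   Context: All groups are finite. $N'$ denotes the commutator (derived) subgroup of $N$, and $\mathrm{Z}(N)$ its center. A complement of a normal subgroup $K \unlhd G$ is a subgroup $C \le G$ with $G = KC$ and $K \cap C = 1$. For $x \in N$, $\gamma_x \in A = \mathrm{Aut}(N)$ is the inner automorphism $\gamma_x(y) = xyx^{-1}$, and $\gamma \colon N \to A$ is the homomorphism $x \mapsto \gamma_x$; the subgroup $\gamma(N')$ is normal in $A$. The holomorph is $\mathrm{Hol}(N) = N \rtimes A$ with multiplication $(n,\alpha)(m,\beta) = (n\alpha(m), \alpha\beta)$. *)

(* Defs.v *)
From HB Require Import structures.
From mathcomp Require Import all_boot all_fingroup all_solvable.

Set Implicit Arguments.
Unset Strict Implicit.
Unset Printing Implicit Defensive.

Local Open Scope group_scope.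

(* Throughout, the finite group N is the whole group [set: gT] of a           *)
(* finGroupType gT.                                                           *)

Section Automorphisms.
Variable gT : finGroupType.

(* The group A = Aut(N).  The product of permutations in MathComp is          *)
(* (s * t) x = t (s x), so Aut [set: gT] is the opposite of A: here the       *)
(* product is composition of functions (see autME).                           *)
Inductive autT : predArgType := AutT (a : {perm gT}) & a \in Aut [set: gT].
Definition aut_perm (a : autT) : {perm gT} := let: AutT s _ := a in s.

HB.instance Definition _ := [isSub for aut_perm].
#[hnf] HB.instance Definition _ := [Finite of autT by <:].

Definition aut_one : autT := AutT (group1 (Aut [set: gT])).
Definition aut_inv (a : autT) : autT := AutT (groupVr (valP a)).
Definition aut_mul (a b : autT) : autT := AutT (groupM (valP b) (valP a)).

Lemma aut_mulA : associative aut_mul.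
Proof. by move=> a b c; apply: val_inj; rewrite /= mulgA. Qed.
Lemma aut_mul1 : left_id aut_one aut_mul.
Proof. by move=> a; apply: val_inj; rewrite /= mulg1. Qed.
Lemma aut_mulV : left_inverse aut_one aut_inv aut_mul.
Proof. by move=> a; apply: val_inj; rewrite /= mulgV. Qed.

HB.instance Definition _ :=
  Finite_isGroup.Build autT aut_mulA aut_mul1 aut_mulV.

Definition aut_fun (a : autT) : gT -> gT := aut_perm a.
Coercion aut_fun : autT >-> Funclass.

Lemma autME (a b : autT) x : (a * b) x = a (b x).
Proof. exact: permM. Qed.
Lemma aut1E x : (1 : autT) x = x.
Proof. exact: perm1. Qed.
Lemma autKV (a : autT) x : a (a^-1 x) = x.
Proof. exact: permKV. Qed.
Lemma autfM (a : autT) : {morph a : x y / x * y}.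
Proof.
by move=> x y; case: a => s /= As; rewrite /aut_fun /= (morphicP (Aut_morphic As)) ?inE.
Qed.
Lemma autf1 (a : autT) : a 1 = 1.
Proof. by apply: (mulgI (a 1)); rewrite -autfM !mulg1. Qed.
Lemma autfV (a : autT) x : a x^-1 = (a x)^-1.
Proof. by apply: (mulgI (a x)); rewrite -autfM !mulgV autf1. Qed.
Lemma autP (a b : autT) : a =1 b -> a = b.
Proof. by move=> eq_ab; apply/val_inj/permP. Qed.

Lemma conj_inj (x : gT) : injective (fun y => x * y * x^-1).
Proof. by move=> y z /mulIg/mulgI. Qed.

Lemma conj_Aut x : perm (@conj_inj x) \in Aut [set: gT].
Proof.
rewrite inE; apply/andP; split; first by apply/subsetP=> y _; rewrite inE.
by apply/morphicP=> y z _ _; rewrite !permE !mulgA mulgKV.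
Qed.

Definition gamma (x : gT) : autT := AutT (conj_Aut x).

Lemma gammaE x y : gamma x y = x * y * x^-1.
Proof. by rewrite /aut_fun permE. Qed.

Lemma gammaM : {in [set: gT] &, {morph gamma : x y / x * y}}.
Proof.
by move=> x y _ _; apply: autP => z; rewrite autME !gammaE invMg !mulgA.
Qed.
Canonical gamma_morphism := Morphism gammaM.

Lemma gammaJ (a : autT) x : a * gamma x * a^-1 = gamma (a x).
Proof.
apply: autP => y; rewrite !autME !gammaE !autfM autfV.
by rewrite -autME mulgV aut1E.
Qed.

Canonical aut_fun_morphism (a : autT) :=
  @Morphism _ _ [set: gT] a (in2W (@autfM a)).

Lemma autf_der1 (a : autT) x :
  x \in [set: gT]^`(1) -> a x \in [set: gT]^`(1).
Proof.
move=> Nx; have: a x \in a @* [set: gT]^`(1) by rewrite mem_morphim ?inE.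
by rewrite morphim_der //; apply/subsetP/dergS/subsetT.
Qed.

Lemma gamma_der1_normal : gamma @* [set: gT]^`(1) <| [set: autT].
Proof.
rewrite /normal subsetT; apply/normsP=> a _; apply/eqP.
rewrite eqEcard cardJg leqnn andbT; apply/subsetP=> _ /imsetP[_ /morphimP[d _ Nd ->] ->].
rewrite /= conjgE -{2}[a]invgK mulgA gammaJ.
by apply: mem_morphim; rewrite ?inE ?autf_der1.
Qed.

Definition TN := [set: autT] / (gamma @* [set: gT]^`(1)).
Canonical TN_group := [group of TN].

End Automorphisms.

Section Holomorph.
Variable gT : finGroupType.
Local Notation A := (autT gT).

(* An alias of gT * A, since pairs already carry the direct product group. *)
Definition holT : Type := (gT * A)%type.
HB.instance Definition _ := Finite.on holT.

Definition hol_one : holT := (1, 1).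
Definition hol_inv (u : holT) : holT := (u.2^-1 u.1^-1, u.2^-1).
Definition hol_mul (u v : holT) : holT := (u.1 * u.2 v.1, u.2 * v.2).

Lemma hol_mulA : associative hol_mul.
Proof. by move=> u v w; congr (_, _); rewrite /= ?autfM ?autME mulgA. Qed.
Lemma hol_mul1 : left_id hol_one hol_mul.
Proof. by case=> n a; congr (_, _); rewrite /= ?aut1E mul1g. Qed.
Lemma hol_mulV : left_inverse hol_one hol_inv hol_mul.
Proof. by case=> n a; congr (_, _); rewrite /= -?autfM mulVg ?autf1. Qed.

HB.instance Definition _ :=
  Finite_isGroup.Build holT hol_mulA hol_mul1 hol_mulV.

Definition hol (n : gT) (a : A) : holT := (n, a).

Lemma holM n a m b : hol n a * hol m b = hol (n * a m) (a * b).
Proof. by []. Qed.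

Definition holD_elt (d : gT) : holT := hol d^-1 (gamma d).

Lemma holD_eltM : {in [set: gT] &, {morph holD_elt : x y / x * y}}.
Proof.
move=> x y _ _; rewrite [RHS]holM; congr (_, _); last by rewrite gammaM ?inE.
by rewrite gammaE invMg !mulgA mulVg mul1g.
Qed.
Canonical holD_elt_morphism := Morphism holD_eltM.

Definition holD : {set holT} := holD_elt @: [set: gT]^`(1).

Lemma group_set_holD : group_set holD.
Proof. by rewrite /holD -morphimEsub ?subsetT //; apply: groupP. Qed.
Canonical holD_group := Group group_set_holD.

Lemma holD_normal : holD <| [set: holT].
Proof.
rewrite /normal subsetT; apply/normsP=> u _; apply/eqP.
rewrite eqEcard cardJg leqnn andbT; apply/subsetP=> _ /imsetP[_ /imsetP[d Nd ->] ->].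
suff ->: holD_elt d ^ u = holD_elt (u^-1.2 d) by apply/imset_f/autf_der1.
rewrite conjgE -{2}[u]invgK; case: (u^-1) => n a; rewrite -/(hol n a) /=.
have ->: (hol n a)^-1 = hol (a^-1 n^-1) a^-1 by [].
rewrite mulgA !holM /holD_elt gammaJ; congr hol.
rewrite autME gammaE /= !autfM !autfV -autME mulgV aut1E.
by rewrite !mulgA mulgKV mulgV mul1g.
Qed.

Definition UN := [set: holT] / holD.
Canonical UN_group := [group of UN].

Definition embN (n : gT) : coset_of holD := coset holD (hol n 1).

Lemma embNM : {in [set: gT] &, {morph embN : x y / x * y}}.
Proof.
have nD u: u \in 'N(holD) by rewrite (subsetP (normal_norm holD_normal)) ?inE.
by move=> x y _ _; rewrite /embN -morphM //= holM aut1E mulg1.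
Qed.
Canonical embN_morphism := Morphism embNM.

End Holomorph.

Arguments gamma {gT} x.
Arguments hol {gT} n a.
Arguments embN {gT} n.

Section FiberProduct.
Variables uT xT tT : finGroupType.

Definition fiber_product (U : {set uT}) (X : {set xT})
    (f : uT -> tT) (g : xT -> tT) : {set uT * xT} :=
  [set p in setX U X | f p.1 == g p.2].

End FiberProduct.

(* Main.v *)
Require Import Defs.
From HB Require Import structures.
From mathcomp Require Import all_boot all_fingroup all_solvable.

(* In U_N the element d of N' is identified with its inner automorphism, so   *)
(* the image of A complements N modulo N', and the projection of Hol(N) to A  *)
(* induces pi with kernel N.  Conversely, a complement of N/N' in B/N' lifts  *)
(* to C <= B with NC = B and N :&: C = N'.  The assignment                    *)
(*    n c |-> (n, conjugation by c)D                                          *)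
(* is well defined because the ambiguity (n d^-1)(d c) with d in N' is        *)
(* exactly what D kills; it is a homomorphism B -> U_N which is the identity  *)
(* on N.  It is injective on N when Z(N) :&: N' = 1, so together with B ->    *)
(* B/N it embeds B in the fiber product; surjectivity follows from            *)
(* ker pi = N.                                                                *)

Set Implicit Arguments.
Unset Strict Implicit.
Unset Printing Implicit Defensive.

Local Open Scope group_scope.

(** The hypothesis on the center enters only through [injm_embN]: an element (n, 1) of D has n in N'
    and gamma_n trivial, so n lies in the intersection of Z(N) and N'. For (iv), the subgroup
    [lifts] of Hol(N) x B is total over B ([lifts_ex]) and its fiber over 1 lies in D ([lifts1]), so
    it is the graph of a homomorphism [to_UN] modulo D. Composed with pi it kills N, which gives the
    map on B/N, and [to_fiber_isom] compares B with the fiber product. *)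

(** * The group U_N, its projection onto T_N, and its splitting modulo N' *)

Section UniversalGroup.
Variable gT : finGroupType.
Local Notation N := [set: gT].
Local Notation gammaD := (gamma @* [set: gT]^`(1)).

Lemma holD_norm (u : holT gT) : u \in 'N(holD gT).
Proof. by rewrite (subsetP (normal_norm (holD_normal gT))) ?inE. Qed.

Lemma gammaD_norm (a : autT gT) : a \in 'N(gammaD).
Proof. by rewrite (subsetP (normal_norm (gamma_der1_normal gT))) ?inE. Qed.

Lemma coset_holM (u v : holT gT) :
  coset (holD gT) (u * v) = coset (holD gT) u * coset (holD gT) v.
Proof. by rewrite morphM ?holD_norm. Qed.

Lemma mem_holD n (a : autT gT) :
  (hol n a \in holD gT) = (n \in N^`(1)) && (a == gamma n^-1).
Proof.
apply/imsetP/andP=> [[d Nd [-> ->]] | [Nn /eqP->]].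
  by rewrite invgK groupV.
by exists n^-1; rewrite ?groupV // /holD_elt invgK.
Qed.

Lemma hol1V n : (hol n 1)^-1 = hol n^-1 1 :> holT gT.
Proof. by apply/eqP; rewrite eq_invg_mul holM aut1E mulgV mulg1. Qed.

Lemma hol_split n (a : autT gT) : hol n a = hol n 1 * hol 1 a.
Proof. by rewrite holM autf1 mulg1 mul1g. Qed.

Lemma embN_eq_coset m n (a : autT gT) :
  embN m = coset (holD gT) (hol n a) -> m^-1 * n \in N^`(1).
Proof.
move=> eq_mn; have: coset (holD gT) ((hol m 1)^-1 * hol n a) = 1.
  by rewrite coset_holM morphV ?holD_norm //= -eq_mn mulVg.
by move/(coset_idr (holD_norm _)); rewrite hol1V holM mem_holD aut1E => /andP[].
Qed.

Lemma injm_embN : 'Z(N) :&: N^`(1) = 1 -> 'injm (@embN gT).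
Proof.
move=> hZ; apply/subsetP=> n /mker Dn.
have := coset_idr (holD_norm _) Dn; rewrite mem_holD => /andP[Nn /eqP eq_n].
rewrite -hZ inE Nn andbT; apply/centerP; split=> [|y _]; first by rewrite inE.
have: gamma n^-1 y = y by rewrite -eq_n aut1E.
by rewrite gammaE invgK /commute => eq_y; rewrite -[in LHS]eq_y !mulgA mulgV mul1g.
Qed.

Definition hol_to_TN (u : holT gT) : coset_of gammaD := coset gammaD u.2.

Lemma hol_to_TNM : {in [set: holT gT] &, {morph hol_to_TN : u v / u * v}}.
Proof. by move=> u v _ _; rewrite /hol_to_TN -morphM ?gammaD_norm. Qed.
Canonical hol_to_TN_morphism := Morphism hol_to_TNM.

Lemma holD_sub_ker_TN : 'ker (coset (holD gT)) \subset 'ker hol_to_TN.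
Proof.
rewrite ker_coset; apply/subsetP=> _ /imsetP[d Nd ->].
apply/kerP; rewrite ?inE //; apply: coset_id.
by apply: mem_morphim; rewrite ?inE.
Qed.

Definition UN_to_TN :=
  factm holD_sub_ker_TN (normal_norm (holD_normal gT)).
Canonical UN_to_TN_morphism : {morphism UN gT >-> coset_of gammaD} :=
  [morphism of UN_to_TN].

Lemma UN_to_TNE n (a : autT gT) :
  UN_to_TN (coset (holD gT) (hol n a)) = coset gammaD a.
Proof. by rewrite /UN_to_TN factmE ?inE. Qed.

Lemma UN_ex (u : coset_of (holD gT)) :
  exists n, exists a, u = coset (holD gT) (hol n a).
Proof. by have [[n a] _ ->] := cosetP u; exists n, a. Qed.

Lemma mem_UN (u : coset_of (holD gT)) : u \in UN gT.
Proof. by have [v _ ->] := cosetP u; rewrite mem_quotient ?inE. Qed.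

Lemma im_UN_to_TN : UN_to_TN @* UN gT = TN gT.
Proof.
apply/setP=> x; apply/morphimP/morphimP=> [[u _ _ ->] | [a _ _ ->]].
  have [n [a ->]] := UN_ex u.
  by exists a; rewrite ?gammaD_norm ?inE //= UN_to_TNE.
by exists (coset (holD gT) (hol 1 a)); rewrite ?mem_UN //= UN_to_TNE.
Qed.

Lemma ker_UN_to_TN : 'ker UN_to_TN = embN @* N.
Proof.
apply/setP=> u; apply/(kerP _ (mem_UN u))/morphimP=> [|[n _ _ ->]]; last first.
  by rewrite [LHS](UN_to_TNE n 1) morph1.
have [n [a ->]] := UN_ex u.
rewrite /= UN_to_TNE => /(coset_idr (gammaD_norm _))/morphimP[d _ Nd ->].
exists (n * d); rewrite ?inE //=.
(* An inner automorphism from N' can be traded, modulo D, for its element d in the first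
   coordinate. *)
have ->: hol n (gamma d) = hol (n * d) 1 * holD_elt d.
  by rewrite holM aut1E mul1g mulgK.
by rewrite coset_kerr //; apply: imset_f.
Qed.

Lemma embN_normal : embN @* N <| UN gT.
Proof. by rewrite -ker_UN_to_TN ker_normal. Qed.

Lemma UN_splits :
  [splits UN gT / (embN @* N^`(1)), over embN @* N / (embN @* N^`(1))].
Proof.
set Q := embN @* N^`(1).
have nQ u : u \in 'N(Q).
  have: Q <| UN gT by rewrite /Q morphim_der ?gFnormal_trans ?embN_normal.
  by case/andP=> _ /subsetP->; rewrite ?mem_UN.
have hol1M : {in [set: autT gT] &, {morph hol (1 : gT) : a b / a * b}}.
  by move=> a b _ _; rewrite holM autf1 mulg1.
pose h := Morphism hol1M.
(* The complement is the image of 1 x A. *)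
apply/splitsP; exists (((h @* setT) / holD gT) / Q)%G.
apply/complP; split; last first.
  rewrite -quotientMl; last by apply/subsetP=> u _; apply: nQ.
  suff ->: embN @* N * (h @* setT / holD gT) = UN gT by [].
  apply/setP=> u; rewrite mem_UN; have [n [a ->]] := UN_ex u.
  rewrite hol_split coset_holM; apply/mulsgP.
  exists (embN n) (coset (holD gT) (hol 1 a)) => //.
    by apply: mem_morphim; rewrite inE.
  by apply: mem_quotient; apply: (mem_morphim h); rewrite inE.
apply/trivgP/subsetP=> _ /setIP[/morphimP[_ _ /morphimP[n _ _ ->] ->]].
case/morphimP=> _ _ /morphimP[_ _ /morphimP[a _ _ ->] ->] /= eq_na.
have: coset Q ((embN n)^-1 * coset (holD gT) (hol 1 a)) = 1.
  by rewrite morphM ?nQ // morphV ?nQ //= eq_na mulVg.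
(* So (1, a)D is [embN (n * d)] with d in N'; comparing first coordinates modulo D puts n * d, hence
   n, in N'. *)
move/(coset_idr (nQ _))/morphimP=> [d _ Nd].
move/(canRL (mulKVg _)); rewrite -embNM ?inE // => /esym/embN_eq_coset.
rewrite mulg1 groupV => Nnd; rewrite coset_id ?set11 //.
by apply: mem_morphim; rewrite ?inE // -(groupMr _ Nd).
Qed.

End UniversalGroup.

(** * The homomorphism from B to U_N given by a lifted complement *)

Section Lifting.
Variables (gT bT : finGroupType) (iota : {morphism [set: gT] >-> bT}).
Variables B C : {group bT}.
Local Notation N := [set: gT].
Hypothesis injm_iota : 'injm iota.
Hypothesis nNB : iota @* N <| B.
Hypothesis mulNC : iota @* N * C = B.
Hypothesis tiNC : iota @* N :&: C = iota @* N^`(1).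

(* The graph of n c |-> (n, conjugation by c), as a relation between Hol(N)   *)
(* and B; being a subgroup of the product, it yields a homomorphism B -> U_N. *)
Definition lifts : {set holT gT * bT} :=
  [set pb | ((iota pb.1.1)^-1 * pb.2 \in C) &&
     [forall x, iota ((pb.1.2 : autT gT) x) == iota x ^ (pb.2^-1 * iota pb.1.1)]].

Lemma liftsP n (a : autT gT) b : reflect
  ((iota n)^-1 * b \in C /\ forall x, iota (a x) = iota x ^ (b^-1 * iota n))
  ((hol n a, b) \in lifts).
Proof.
rewrite inE; apply: (iffP andP) => -[Cb /=].
  by move/forallP=> Ea; split=> // x; apply/eqP.
by move=> Ea; split=> //; apply/forallP=> x; apply/eqP.
Qed.

Lemma group_set_lifts : group_set lifts.
Proof.
apply/group_setP; split=> [|[[n a] b] [[m a'] b'] /liftsP[Cb Ea] /liftsP[Cb' Ea']].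
  apply/liftsP; rewrite morph1 mulg1 invg1; split=> // x.
  by rewrite aut1E conjg1.
rewrite [_ * _](_ : _ = (hol (n * a m) (a * a'), b * b')) //.
(* With c = n^-1 b and c' = m^-1 b', the automorphism a is x |-> c x c^-1; this identity makes the
   C-part of the product equal to c c'. *)
have E : iota (n * a m) = b * iota m * b^-1 * iota n.
  by rewrite morphM ?inE // Ea conjgE !invMg !invgK !mulgA mulgV mul1g.
apply/liftsP; split=> [|x]; rewrite E.
  rewrite !invMg invgK !mulgA mulgKV.
  by have := groupM Cb Cb'; rewrite !mulgA.
by rewrite autME Ea Ea' -conjgM; congr (_ ^ _); rewrite invMg !mulgA mulgKV.
Qed.
Canonical lifts_group := Group group_set_lifts.

(** Over b = 1 the C-part is n^-1, so n lies in both N and C, hence in N', and a is conjugation by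
    n^-1: this is an element of D. *)
Lemma lifts1 p : (p, 1) \in lifts -> p \in holD gT.
Proof.
case: p => n a /liftsP[]; rewrite mulg1 invg1 groupV => Cn Ea.
have /morphimP[d _ Nd /(injmP injm_iota) En] : iota n \in iota @* N^`(1).
  by rewrite -tiNC inE Cn andbT mem_morphim ?inE.
rewrite mem_holD En ?inE // Nd /=; apply/eqP/autP=> x.
apply: (injmP injm_iota); rewrite ?inE // Ea mul1g En ?inE //.
by rewrite -morphJ ?inE // gammaE invgK conjgE mulgA.
Qed.

Lemma lifts_coset p q b :
  (p, b) \in lifts -> (q, b) \in lifts -> coset (holD gT) p = coset (holD gT) q.
Proof.
move=> Lp Lq; apply/eqP; rewrite eq_mulgV1 -morphV ?holD_norm // -coset_holM.
apply/eqP/coset_id/lifts1.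
have -> : (p * q^-1, 1) = (p, b) * (q, b)^-1 by rewrite -(mulgV b).
by rewrite groupM ?groupV.
Qed.

Lemma lifts_embN n : (hol n 1, iota n) \in lifts.
Proof. by apply/liftsP; rewrite mulVg group1; split=> // x; rewrite aut1E conjg1. Qed.

Lemma conj_autT_ex c :
  c \in 'N(iota @* N) -> exists a : autT gT, forall x, iota (a x) = iota x ^ c^-1.
Proof.
move=> nc; pose f x := invm injm_iota (iota x ^ c^-1).
have fE x : iota (f x) = iota x ^ c^-1.
  rewrite /f invmK // memJ_norm ?groupV // mem_morphim ?inE //.
have f_inj : injective f.
  move=> x y /(congr1 iota); rewrite !fE => /conjg_inj.
  by apply: (injmP injm_iota); rewrite ?inE.
have f_aut : perm f_inj \in Aut N.
  rewrite inE; apply/andP; split; first by apply/subsetP=> x _; rewrite inE.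
  apply/morphicP=> x y _ _; rewrite !permE.
  by apply: (injmP injm_iota); rewrite ?inE // !(fE, morphM, conjMg) ?inE.
by exists (AutT f_aut) => x; rewrite /aut_fun permE.
Qed.

Lemma lifts_ex b : b \in B -> exists p, (p, b) \in lifts.
Proof.
rewrite -mulNC => /mulsgP[_ c /morphimP[n _ _ ->] Cc ->].
have [|a Ea] := @conj_autT_ex c.
  rewrite (subsetP (normal_norm nNB)) // -mulNC.
  by apply: (subsetP (mulG_subr _ _)).
exists (hol n a); apply/liftsP; rewrite mulKg; split=> // x.
by rewrite Ea invMg mulgKV.
Qed.

(** By [lifts_coset] the coset does not depend on the chosen p; by [lifts_ex] the default 1 is never
    reached on B. *)
Definition to_UN b : coset_of (holD gT) :=
  coset (holD gT) (odflt 1 [pick p | (p, b) \in lifts]).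

Lemma to_UNE p b : (p, b) \in lifts -> to_UN b = coset (holD gT) p.
Proof.
move=> Lp; rewrite /to_UN; case: pickP => [q Lq | /(_ p)]; last by rewrite Lp.
exact: lifts_coset Lq Lp.
Qed.

Lemma to_UNM : {in B &, {morph to_UN : b c / b * c}}.
Proof.
move=> b c /lifts_ex[p Lp] /lifts_ex[q Lq].
rewrite (to_UNE Lp) (to_UNE Lq) -coset_holM; apply: to_UNE.
exact: (groupM Lp Lq).
Qed.
Canonical to_UN_morphism := Morphism to_UNM.

Lemma to_UN_iota n : to_UN (iota n) = embN n.
Proof. exact: to_UNE (lifts_embN n). Qed.

Lemma iotaB n : iota n \in B.
Proof. by rewrite (subsetP (normal_sub nNB)) // mem_morphim ?inE. Qed.

Lemma B_norm b : b \in B -> b \in 'N(iota @* N).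
Proof. exact/subsetP/normal_norm. Qed.

(** * The induced map from B/N to T_N and the fiber product *)

Definition to_TN b := UN_to_TN (to_UN b).

Lemma to_TNM : {in B &, {morph to_TN : b c / b * c}}.
Proof. by move=> b c Bb Bc; rewrite /to_TN to_UNM // morphM ?mem_UN. Qed.
Canonical to_TN_morphism := Morphism to_TNM.

Lemma to_TN_iota n : to_TN (iota n) = 1.
Proof.
rewrite /to_TN to_UN_iota; apply/mker; rewrite ker_UN_to_TN.
by rewrite mem_morphim ?inE.
Qed.

Lemma ker_coset_to_TN : 'ker (coset (iota @* N)) \subset 'ker to_TN.
Proof.
rewrite ker_coset; apply/subsetP=> _ /morphimP[n _ _ ->].
by apply/kerP; [exact: iotaB | exact: to_TN_iota].
Qed.

Definition quot_to_TN := factm ker_coset_to_TN (normal_norm nNB).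
Canonical quot_to_TN_morphism :
    {morphism B / (iota @* N) >-> coset_of (gamma @* N^`(1))} :=
  [morphism of quot_to_TN].

Lemma quot_to_TNE b :
  b \in B -> quot_to_TN (coset (iota @* N) b) = UN_to_TN (to_UN b).
Proof. by move=> Bb; rewrite /quot_to_TN factmE. Qed.

Definition to_fiber b : coset_of (holD gT) * coset_of (iota @* N) :=
  (to_UN b, coset (iota @* N) b).

Lemma to_fiberM : {in B &, {morph to_fiber : b c / b * c}}.
Proof.
by move=> b c Bb Bc; rewrite /to_fiber to_UNM // morphM ?B_norm.
Qed.
Canonical to_fiber_morphism := Morphism to_fiberM.

Lemma to_fiber_iota n : to_fiber (iota n) = (embN n, 1).
Proof.
by rewrite /to_fiber to_UN_iota coset_id // mem_morphim ?inE.
Qed.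

Lemma to_fiber_isom : 'injm (@embN gT) ->
  isom B (fiber_product (UN gT) (B / (iota @* N)) (@UN_to_TN gT) quot_to_TN)
    to_fiber.
Proof.
move=> injm_embN; have <-: to_fiber @* B = fiber_product (UN gT)
    (B / (iota @* N)) (@UN_to_TN gT) quot_to_TN.
  apply/setP=> -[u x]; apply/morphimP/idP=> [[b _ Bb [-> ->]] | ].
    by rewrite !inE /= mem_UN mem_quotient // quot_to_TNE /=.
  rewrite !inE /= => /andP[/andP[_ /morphimP[b _ Bb ->]]].
  rewrite quot_to_TNE // => /eqP Epi.
  (* A lift b of x reaches u only up to ker pi = N; multiplying b by that element of N corrects u
     without changing x. *)
  have: u * (to_UN b)^-1 \in 'ker (@UN_to_TN gT).
    by apply/kerP; rewrite ?mem_UN // morphM ?morphV ?mem_UN //= Epi mulgV.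
  rewrite ker_UN_to_TN => /morphimP[n _ _ /(canRL (mulgKV _)) ->].
  exists (iota n * b); rewrite ?groupM ?iotaB //.
  rewrite /= to_fiberM ?iotaB // to_fiber_iota /to_fiber.
  by congr (_, _); rewrite /= mul1g.
apply/isomP; split=> //; apply/subsetP=> b Kb; have Bb := dom_ker Kb.
have [Eb1 Eb2]: to_UN b = 1 /\ coset (iota @* N) b = 1 by case: (mker Kb).
have /morphimP[n _ _ En] := coset_idr (B_norm Bb) Eb2.
have: embN n = embN 1 by rewrite -to_UN_iota -En Eb1 morph1.
by move/(injmP injm_embN)=> E1; rewrite En E1 ?inE // morph1.
Qed.

Lemma im_to_fiber_iota : to_fiber @* (iota @* N) = setX (embN @* N) 1.
Proof.
apply/setP=> -[u x]; apply/morphimP/setXP => [[_ _ /morphimP[n _ _ ->]] |].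
  by rewrite /= to_fiber_iota => -[-> ->]; rewrite group1 mem_morphim ?inE.
case=> /morphimP[n _ _ ->] /set1P->.
by exists (iota n); rewrite ?iotaB ?mem_morphim ?inE //= to_fiber_iota.
Qed.

End Lifting.

(** C is the full preimage of a complement of M / K, and M is the preimage of M / K because it
    contains K. *)
Lemma splits_quotient_ex (bT : finGroupType) (B M K : {group bT}) :
  M <| B -> K <| B -> K \subset M -> [splits B / K, over M / K] ->
  exists C : {group bT}, M * C = B /\ M :&: C = K.
Proof.
move=> nMB nKB sKM /splitsP[Cb /complP[tiMC mulMC]].
exists (coset K @*^-1 Cb)%G; split.
  rewrite -[LHS]/(M * coset K @*^-1 Cb).
  by rewrite -{1}(quotientGK (normalS sKM (normal_sub nMB) nKB)) -cosetpreM mulMC quotientGK.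
by rewrite /= -{1}(quotientGK (normalS sKM (normal_sub nMB) nKB)) -morphpreI tiMC cosetpre1.
Qed.

Theorem theorem3p1 (gT : finGroupType)
  (hZ : 'Z([set: gT]) :&: [set: gT]^`(1) = 1) :
  (* (i) *)
  ('injm (@embN gT) /\ embN @* [set: gT] <| UN gT) /\
  exists pi : {morphism UN gT >-> coset_of (gamma @* [set: gT]^`(1))},
  [/\ (* (ii) *)
      [/\ forall (n : gT) (a : autT gT),
            pi (coset (holD gT) (hol n a)) =
              coset (gamma @* [set: gT]^`(1)) a,
          pi @* UN gT = TN gT
        & 'ker pi = embN @* [set: gT]],
      (* (iii) *)
      [splits UN gT / (embN @* [set: gT]^`(1)),
         over (embN @* [set: gT]) / (embN @* [set: gT]^`(1))]
    & (* (iv) *)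
      forall (bT : finGroupType) (B : {group bT})
             (iota : {morphism [set: gT] >-> bT}),
        'injm iota ->
        iota @* [set: gT] <| B ->
        [splits B / (iota @* [set: gT]^`(1)),
           over (iota @* [set: gT]) / (iota @* [set: gT]^`(1))] ->
        exists (fbar : {morphism B / (iota @* [set: gT]) >->
                          coset_of (gamma @* [set: gT]^`(1))})
               (phi : {morphism B >->
                         coset_of (holD gT) *
                         coset_of (iota @* [set: gT])}),
          [/\ fbar @* (B / (iota @* [set: gT])) \subset TN gT,
              isom B
                (fiber_product (UN gT) (B / (iota @* [set: gT])) pi fbar) phi
            & phi @* (iota @* [set: gT]) = setX (embN @* [set: gT]) 1]].
Proof.
split; first by split; [exact: injm_embN | exact: embN_normal].
exists (UN_to_TN_morphism gT).
split; [split | exact: UN_splits |].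
- exact: UN_to_TNE.
- exact: im_UN_to_TN.
- exact: ker_UN_to_TN.
move=> bT B iota injm_iota nNB splB.
have nN'B : iota @* [set: gT]^`(1) <| B by rewrite morphim_der ?gFnormal_trans.
have sN'N : iota @* [set: gT]^`(1) \subset iota @* [set: gT].
  by rewrite morphimS ?subsetT.
have [C [mulNC tiNC]] := splits_quotient_ex nNB nN'B sN'N splB.
exists (quot_to_TN_morphism injm_iota nNB mulNC tiNC).
exists (to_fiber_morphism injm_iota nNB mulNC tiNC).
split.
- by apply/subsetP=> x _; have [a _ ->] := cosetP x; rewrite mem_quotient ?inE.
- exact/to_fiber_isom/injm_embN.
- exact: im_to_fiber_iota.
Qed.
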